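(* Let $G$ be a finite abelian group and let $S\subseteq G$ be a symmetric subset (i.e. $-S=S$) with $0\notin S$. Then the regular graphs $X(G,S)$ and $X^+(G,S)$ are equienergetic, i.e. $E(X(G,S))=E(X^+(G,S))$.
   Context: For a finite abelian group $G$ (written additively) and a symmetric subset $S\subseteq G$ with $0\notin S$: the Cayley graph $X(G,S)$ has vertex set $G$, with $v,w$ adjacent iff $w-v\in S$; the Cayley sum graph $X^+(G,S)$ has vertex set $G$, with $v,w$ adjacent iff $v+w\in S$ (so there is a loop at $x$ exactly when $x+x\in S$). Both are undirected and $|S|$-regular (a loop contributes $1$ to the degree). The eigenvalues of a graph are those of its adjacency matrix (entry $1$ at $(v,w)$ iff $v,w$ are adjacent, so a loop gives a diagonal entry $1$). The energy $E(\Gamma)$ of a graph $\Gamma$ is the sum of the absolute values of its eigenvalues counted with multiplicity. Two graphs with the same number of vertices are equienergetic if they have the same energy. *)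

(* Defs.v *)
From HB Require Import structures.
From mathcomp Require Import all_boot all_order all_algebra all_field.

Set Implicit Arguments.
Unset Strict Implicit.
Unset Printing Implicit Defensive.

Import GRing.Theory Num.Theory.
Local Open Scope ring_scope.

(* A finite graph, possibly with loops, is a relation e on a finType V; it is
   undirected when e is symmetric. Vertices are numbered by enum_val so that
   the adjacency matrix is a MathComp square matrix. Its characteristic
   polynomial splits over algC, which thus contains all the eigenvalues. *)
Definition adjmx (V : finType) (e : rel V) : 'M[algC]_#|V| :=
  \matrix_(i, j) (e (enum_val i) (enum_val j))%:R.

(* Each eigenvalue is repeated according to its multiplicity as a root of the
   characteristic polynomial, see spectrumE. *)
Definition spectrum (n : nat) (A : 'M[algC]_n) : seq algC :=
  sval (closed_field_poly_normal (char_poly A)).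

Lemma spectrumE (n : nat) (A : 'M[algC]_n) :
  char_poly A = \prod_(x <- spectrum A) ('X - x%:P).
Proof.
rewrite /spectrum; case: closed_field_poly_normal => r /= {1}->.
by rewrite (monicP (char_poly_monic A)) scale1r.
Qed.

Lemma mem_spectrum (n : nat) (A : 'M[algC]_n) (a : algC) :
  (a \in spectrum A) = eigenvalue A a.
Proof. by rewrite eigenvalue_root_char spectrumE root_prod_XsubC. Qed.

Definition energy (V : finType) (e : rel V) : algC :=
  \sum_(x <- spectrum (adjmx e)) `|x|.

Definition equienergetic (V W : finType) (e : rel V) (f : rel W) : Prop :=
  #|V| = #|W| /\ energy e = energy f.

(* A loop at v contributes 1 to the degree of v. *)
Definition regular_graph (V : finType) (k : nat) (e : rel V) : Prop :=
  forall v, #|[set w | e v w]| = k.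

Definition symmetric_subset (G : finZmodType) (S : {set G}) : Prop :=
  [set - s | s in S] = S.

Definition cayley_graph (G : finZmodType) (S : {set G}) : rel G :=
  fun v w => w - v \in S.

Definition cayley_sum_graph (G : finZmodType) (S : {set G}) : rel G :=
  fun v w => v + w \in S.

Lemma cayley_graph_sym (G : finZmodType) (S : {set G}) :
  symmetric_subset S -> symmetric (cayley_graph S).
Proof.
move=> symS v w; rewrite /cayley_graph -opprB -{1}symS.
by rewrite mem_imset //; apply: oppr_inj.
Qed.

Lemma cayley_sum_graph_sym (G : finZmodType) (S : {set G}) :
  symmetric (cayley_sum_graph S).
Proof. by move=> v w; rewrite /cayley_sum_graph addrC. Qed.

Lemma cayley_graph_regular (G : finZmodType) (S : {set G}) :
  regular_graph #|S| (cayley_graph S).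
Proof.
move=> v; rewrite -(card_imset S (addrI v)); apply: eq_card => w.
rewrite inE /cayley_graph; apply/idP/imsetP => [Sw | [s Ss ->]].
  by exists (w - v); rewrite // addrC subrK.
by rewrite addrC addKr.
Qed.

Lemma cayley_sum_graph_regular (G : finZmodType) (S : {set G}) :
  regular_graph #|S| (cayley_sum_graph S).
Proof.
move=> v; rewrite -(card_imset S (addrI (- v))); apply: eq_card => w.
rewrite inE /cayley_sum_graph; apply/idP/imsetP => [Sw | [s Ss ->]].
  by exists (v + w); rewrite // addKr.
by rewrite addNKr.
Qed.

(* Main.v *)
Require Import Defs.
From mathcomp Require Import all_boot all_order all_algebra all_field.

(** Let A and B be the adjacency matrices of the Cayley graph and of the Cayley
    sum graph. They satisfy B = P A, where P is the permutation matrix of the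
    involution v |-> - v, and P commutes with A because S is symmetric; hence
    A ^ 2 = B ^ 2 ([cayley_adjmx_sqr]).

    The square of a matrix determines the sum of the absolute values of its
    eigenvalues ([eq_sqr_sum_norm_spectrum]). Indeed, writing p for the
    characteristic polynomial of A, the product p(X) p(- X) is the determinant
    of (X - A) (- X - A) = A ^ 2 - X ^ 2, and its multiset of roots consists
    of the eigenvalues of A together with their opposites. This multiset
    depends only on A ^ 2, and the sum of the absolute values of its members is
    twice the one sought. *)

Import GRing.Theory Num.Theory.
Local Open Scope ring_scope.

Lemma size_spectrum (n : nat) (A : 'M[algC]_n) : size (spectrum A) = n.
Proof.
by apply: succn_inj; rewrite -(size_prod_XsubC _ id) -spectrumE size_char_poly.
Qed.

(** Substituting - X for X in a determinant is done entrywise, which turns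
    X - A into - X - A. *)
Lemma char_poly_mul_compN (R : comNzRingType) (n : nat) (A : 'M[R]_n) :
  char_poly A * (char_poly A \Po - 'X) =
  \det (map_mx polyC (A *m A) - ('X ^+ 2)%:M).
Proof.
rewrite {2}/char_poly.
have -> : \det (char_poly_mx A) \Po - 'X =
          \det (map_mx (comp_poly (- 'X)) (char_poly_mx A)) by rewrite det_map_mx.
have -> : map_mx (comp_poly (- 'X)) (char_poly_mx A) =
          - 'X%:M - map_mx polyC A.
  apply/matrixP=> i j; rewrite !mxE rmorphB rmorphMn /= comp_polyC comp_polyX.
  by rewrite mulNrn.
rewrite -det_mulmx; congr (\det _).
rewrite /char_poly_mx mulmxBl !mulmxBr !mulmxN -scalar_mxM expr2 map_mxM /=.
by rewrite scalar_mxC opprD !opprK addrA addrNK addrC.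
Qed.

(** Each factor X - x of the characteristic polynomial becomes
    - X - x = - (X - (- x)), whence the opposite eigenvalues and the sign. *)
Lemma char_poly_mul_compN_spectrum (n : nat) (A : 'M[algC]_n) :
  char_poly A * (char_poly A \Po - 'X) =
  (-1) ^+ n * \prod_(x <- spectrum A ++ map -%R (spectrum A)) ('X - x%:P).
Proof.
rewrite big_cat big_map /= spectrumE mulrCA; congr (_ * _).
rewrite rmorph_prod /=.
under eq_bigr => x _ do
  rewrite rmorphB /= comp_polyX comp_polyC -opprD -mulN1r -[x in x%:P]opprK polyCN.
rewrite big_split big_const_seq count_predT size_spectrum iter_mulr_1 /=.
by [].
Qed.

(** Only the squares of the eigenvalues can be read off the square of A, but an
    absolute value does not see the lost sign. *)
Lemma eq_sqr_sum_norm_spectrum (n : nat) (A B : 'M[algC]_n) :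
  A *m A = B *m B ->
  \sum_(x <- spectrum A) `|x| = \sum_(x <- spectrum B) `|x|.
Proof.
move=> eqAB.
have double (s : seq algC) :
    \sum_(x <- s ++ map -%R s) `|x| = (\sum_(x <- s) `|x|) *+ 2.
  rewrite big_cat big_map /= mulr2n; congr (_ + _).
  by apply: eq_bigr => x _; rewrite normrN.
apply: (@pmulrnI _ 2) => //; rewrite -!double.
apply/perm_big; apply/prod_XsubC_eq.
apply: (can_inj (signrMK n)).
by rewrite -!char_poly_mul_compN_spectrum !char_poly_mul_compN eqAB.
Qed.

Lemma adjmx_sqrE (V : finType) (e : rel V) i j :
  (adjmx e *m adjmx e) i j =
  \sum_u (e (enum_val i) u)%:R * (e u (enum_val j))%:R.
Proof.
rewrite mxE (reindex enum_rank) /=; last exact: onW_bij (enum_rank_bij V).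
by apply: eq_bigr => u _; rewrite !mxE enum_rankK.
Qed.

(** Negation of the middle vertex matches the walks of length 2 from v to w in
    the two graphs. *)
Lemma cayley_adjmx_sqr (G : finZmodType) (S : {set G}) :
  symmetric_subset S ->
  adjmx (cayley_graph S) *m adjmx (cayley_graph S) =
  adjmx (cayley_sum_graph S) *m adjmx (cayley_sum_graph S).
Proof.
move=> symS; apply/matrixP=> i j; rewrite !adjmx_sqrE.
rewrite (reindex_inj oppr_inj) /=; apply: eq_bigr => u _.
rewrite (cayley_graph_sym symS (enum_val i)) /cayley_graph /cayley_sum_graph.
by rewrite !opprK [enum_val j + u]addrC.
Qed.

Theorem theorem2p7 (G : finZmodType) (S : {set G})
    (symS : symmetric_subset S) (S0 : 0 \notin S) :
  equienergetic (cayley_graph S) (cayley_sum_graph S).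
Proof.
by split=> //; apply: eq_sqr_sum_norm_spectrum; apply: cayley_adjmx_sqr.
Qed.
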